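(* Let $(M,F)$ be a connected Finsler manifold of dimension $n$ and $p\in M$. Using normal coordinates around $p$ with respect to the averaged Riemannian metric $\gamma$, the system of the compatibility equations is $v$-solvable for $\rho$ at $p$ if and only if the following two conditions are satisfied: (1) all vertically contact elements of $T_pM\setminus\{\mathbf 0\}$ are also horizontal contact; (2) for every $v\in T_pM\setminus\{\mathbf 0\}$ and any triplet of distinct indices $i,j,k$ we have $$f_{ij}(v)\,\partial_kF(v)+f_{jk}(v)\,\partial_iF(v)+f_{ki}(v)\,\partial_jF(v)=0$$ provided that $f_{ij}(v)\neq 0$.
   Context: Local coordinates $u^1,\dots,u^n$ on $M$ induce coordinates $x^i=u^i\circ\pi$, $y^i(v)=v(u^i)$ on $TM$, where $\pi\colon TM\to M$ is the canonical projection; $\partial_i=\partial/\partial x^i$ and $\dot\partial_i=\partial/\partial y^i$. A Finsler metric is a non-negative continuous function $F\colon TM\to\mathbb R$, smooth on the complement of the zero section, with $F(tv)=tF(v)$ for $t>0$, $F(v)=0$ iff $v=\mathbf 0$, and such that the Hessian $g_{ij}=\dot\partial_i\dot\partial_jE$ of $E=F^2/2$ is positive definite at all nonzero $v$. The averaged Riemannian metric $\gamma$ of $F$ is $\gamma_p(X,Y)=\int_{S_p} g_{ij}(v)X^iY^j\,d\mu_p(v)$, where $S_p=\{v\in T_pM: F(v)=1\}$ and $\mu_p$ is the volume measure induced on $S_p$ by the Riemannian metric $g_{ij}$ on $T_pM\setminus\{\mathbf 0\}$. Fix $p$ and normal coordinates with respect to $\gamma$ around $p$, with $\gamma_{ij}(p)=\delta_{ij}$.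 For $v\in T_pM\setminus\{\mathbf 0\}$ let $G_v=[\dot\partial_1F(v),\dots,\dot\partial_nF(v)]$, $C_v=[v^1,\dots,v^n]$, $H_v=[\partial_1F(v),\dots,\partial_nF(v)]$ and $f_{ij}=y^i\dot\partial_jF-y^j\dot\partial_iF$. The vector $v$ is vertically contact if $G_v$ and $C_v$ are parallel (linearly dependent), and horizontal contact if $H_v=\mathbf 0$. The system of the compatibility equations (for a semi-symmetric compatible linear connection, with torsion $T(X,Y)=\rho(Y)X-\rho(X)Y$) is called $v$-solvable for $\rho$ at $p$ if for every $v\in T_pM\setminus\{\mathbf 0\}$ there is $(\rho_1,\dots,\rho_n)\in\mathbb R^n$ (possibly depending on $v$) such that $\sum_{j=1}^n f_{ij}(v)\rho_j=-\partial_iF(v)$ for all $i=1,\dots,n$. *)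

(* Defs.v *)
From HB Require Import structures.
From mathcomp Require Import all_boot all_order all_algebra.
From mathcomp Require Import all_classical all_reals all_analysis.
Set Implicit Arguments.
Unset Strict Implicit.
Unset Printing Implicit Defensive.
Import Order.TTheory GRing.Theory Num.Theory.
Import numFieldNormedType.Exports.
Local Open Scope classical_set_scope.
Local Open Scope ring_scope.

Section Calculus.
Variable R : realType.

(* Meaningful for open U; in finite dimension this is the usual notion in terms
   of iterated partial derivatives. *)
Fixpoint Ck_on (k : nat) (V W : normedModType R) (U : set V) (f : V -> W)
    : Prop :=
  {in U, continuous f} /\
  (if k is k'.+1 then
     forall v : V, {in U, forall x, derivable f x v} /\ Ck_on k' U ('D_v f)
   else True).

Definition smooth_on (V W : normedModType R) (U : set V) (f : V -> W) : Prop :=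
  forall k, Ck_on k U f.

Definition basis_vec n (i : 'I_n) : 'rV[R]_n := delta_mx 0 i.

Definition borelV (n : nat) := g_sigma_algebraType (@open 'rV[R]_n).

(* Lebesgue measure on R^m (on Borel sets), by slicing along the first
   coordinate as in the library's product measures. *)
Fixpoint lebesgueV (m : nat) : set (borelV m) -> \bar R :=
  match m return set (borelV m) -> \bar R with
  | 0 => fun A => (\1_A (0 : 'rV[R]_0))%:E
  | m'.+1 => fun A =>
      (\int[lebesgue_measure]_x
         lebesgueV [set y : borelV m' | A (row_mx (x%:M : 'rV[R]_1) y)])%E
  end.

(* Rows are the partial derivatives of s. *)
Definition jacobi_mx m n (s : 'rV[R]_m -> 'rV[R]_n) (x : 'rV[R]_m)
  : 'M[R]_(m, n) := \matrix_(a < m) 'D_(basis_vec a) s x.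

(* Local parametrization of a hypersurface S of R^n; by invariance of domain
   s maps W homeomorphically onto an open part of S. *)
Definition local_param n (S : set 'rV[R]_n)
    (W : set 'rV[R]_n.-1) (s : 'rV[R]_n.-1 -> 'rV[R]_n) : Prop :=
  [/\ open W, smooth_on W s, {in W &, injective s},
      {in W, forall x, row_free (jacobi_mx s x)} & s @` W `<=` S].

(* mu is the volume measure induced on the hypersurface S by the Riemannian
   metric g on (a neighbourhood of S in) R^n, extended by 0 outside S. *)
Definition induced_volume n (g : 'rV[R]_n -> 'M[R]_n) (S : set 'rV[R]_n)
    (mu : {measure set (borelV n) -> \bar R}) : Prop :=
  mu (~` S) = 0%E /\
  forall W s, local_param S W s ->
  forall B : set (borelV n.-1), measurable B -> B `<=` W ->
    mu (s @` B) =
    (\int[@lebesgueV n.-1]_(x in B)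
       (Num.sqrt (\det (jacobi_mx s x *m g (s x) *m (jacobi_mx s x)^T)))%:E)%E.

End Calculus.

Section Manifold.
Variables (R : realType) (n : nat) (M : topologicalType).

(* phi and psi take arbitrary values outside dom and phi @` dom. *)
Record chart := Chart {
  dom : set M;
  phi : M -> 'rV[R]_n;
  psi : 'rV[R]_n -> M;
  chart_dom_open : open dom;
  chart_img_open : open (phi @` dom);
  chart_phi_cont : {in dom, continuous phi};
  chart_psi_cont : {in phi @` dom, continuous psi};
  chart_phiK : {in dom, cancel phi psi} }.

Definition img (c : chart) : set 'rV[R]_n := phi c @` dom c.

Definition compatible (c c' : chart) : Prop :=
  smooth_on (phi c @` (dom c `&` dom c')) (phi c' \o psi c) /\
  smooth_on (phi c' @` (dom c `&` dom c')) (phi c \o psi c').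

(* atlas is the maximal atlas. *)
Definition smooth_manifold (atlas : set chart) : Prop :=
  [/\ hausdorff_space M, @second_countable M,
      (forall p : M, exists2 c, atlas c & dom c p),
      (forall c c', atlas c -> atlas c' -> compatible c c') &
      forall c, (forall c', atlas c' -> compatible c c') -> atlas c].

Variable atlas : set chart.

Definition smooth_at (p : M) (f : M -> R) : Prop :=
  forall c, atlas c -> dom c p ->
  exists W : set 'rV[R]_n, [/\ open W, W (phi c p), W `<=` img c &
    smooth_on (W := R^o) W (f \o psi c)].

(* Tangent vectors at p are the point derivations on functions smooth near p.
   They are extended by 0 to the other functions so that equality of tangent
   vectors is equality of functionals; locality follows from the Leibniz rule,
   since indicators of neighbourhoods of p are smooth at p. *)
Definition functional := (M -> R) -> R^o.

Definition tangent (p : M) (v : functional) : Prop :=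
  [/\ forall (a : R) (f g : M -> R), smooth_at p f -> smooth_at p g ->
        v (fun q => a * f q + g q) = a * v f + v g,
      forall f g : M -> R, smooth_at p f -> smooth_at p g ->
        v (fun q => f q * g q) = f p * v g + g p * v f &
      forall f, ~ smooth_at p f -> v f = 0].

(* The coordinate vector d/du^i at q. *)
Definition coord_vec (c : chart) (q : M) (i : 'I_n) : functional := fun f =>
  if `[< smooth_at q f >] then
    'D_(basis_vec R i) (f \o psi c : 'rV[R]_n -> R^o) (phi c q) else 0.

Definition vec_of (c : chart) (q : M) (y : 'rV[R]_n) : functional :=
  \sum_i y 0 i *: coord_vec c q i.

(* y^i(v) = v(u^i) *)
Definition comps (c : chart) (v : functional) : 'rV[R]_n :=
  \row_i v (fun q => phi c q 0 i).

(* The induced coordinates (x, y) of v on TM. *)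
Definition tcoords (c : chart) (p : M) (v : functional) : 'rV[R]_n * 'rV[R]_n :=
  (phi c p, comps c v).

(* A function F on TM is given by its values F p v for tangent p v; its other
   values are never used. *)
Section FunctionOnTM.
Variable F : M -> functional -> R.

Definition in_coords (c : chart) (z : 'rV[R]_n * 'rV[R]_n) : R^o :=
  F (psi c z.1) (vec_of c (psi c z.1) z.2).

Definition hpartial (c : chart) (i : 'I_n) (z : 'rV[R]_n * 'rV[R]_n) : R :=
  'D_(basis_vec R i, 0) (in_coords c) z.

Definition vpartial (c : chart) (i : 'I_n) (z : 'rV[R]_n * 'rV[R]_n) : R :=
  'D_(0, basis_vec R i) (in_coords c) z.

Definition energy (c : chart) (z : 'rV[R]_n * 'rV[R]_n) : R^o :=
  in_coords c z ^+ 2 / 2.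

Definition hessian (c : chart) (z : 'rV[R]_n * 'rV[R]_n) : 'M[R]_n :=
  \matrix_(i, j)
    'D_(0, basis_vec R i) ('D_(0, basis_vec R j) (energy c)) z.

(* The smooth structure of TM is the one of the induced charts, so regularity
   of F is that of its coordinate expressions. *)
Definition finsler_metric : Prop :=
  [/\ (forall p v, tangent p v -> 0 <= F p v) /\
      (forall c, atlas c ->
         {in [set z | img c z.1], continuous (in_coords c)}),
      forall c, atlas c ->
        smooth_on [set z | img c z.1 /\ z.2 != 0] (in_coords c),
      forall p v (t : R), tangent p v -> 0 < t -> F p (t *: v) = t * F p v,
      forall p v, tangent p v -> (F p v = 0 <-> v = 0) &
      forall c p v, atlas c -> dom c p -> tangent p v -> v <> 0 ->
        forall w : 'rV[R]_n, w != 0 ->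
          0 < (w *m hessian c (tcoords c p v) *m w^T) 0 0].

(* gamma is the averaged metric of F. The indicatrix S_p and its volume measure
   are transported to R^n by the coordinates y^i of any chart around p. *)
Definition averaged_metric (gamma : M -> functional -> functional -> R)
    : Prop :=
  forall c p, atlas c -> dom c p ->
  let S := [set y : 'rV[R]_n | in_coords c (phi c p, y) = 1] in
  let g := fun y : 'rV[R]_n => hessian c (phi c p, y) in
  exists mu : {measure set (borelV R n) -> \bar R},
    induced_volume g S mu /\
    forall X Y, tangent p X -> tangent p Y ->
      gamma p X Y =
      \int[mu]_(y in S) (\sum_i \sum_j g y i j * comps c X 0 i * comps c Y 0 j).

End FunctionOnTM.

Section NormalCoordinates.
Variable gamma : M -> functional -> functional -> R.

Definition metric_mx (c : chart) (x : 'rV[R]_n) : 'M[R]_n :=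
  \matrix_(i, j) gamma (psi c x) (coord_vec c (psi c x) i)
                                 (coord_vec c (psi c x) j).

Definition dmetric (c : chart) (x : 'rV[R]_n) (i j l : 'I_n) : R :=
  'D_(basis_vec R i) (fun x' => metric_mx c x' j l : R^o) x.

(* Gamma^k_ij *)
Definition christoffel (c : chart) (x : 'rV[R]_n) (k i j : 'I_n) : R :=
  2^-1 * \sum_l invmx (metric_mx c x) k l *
    (dmetric c x i j l + dmetric c x j i l - dmetric c x l i j).

Definition geodesic_on (I : set R) (alpha : R -> M) : Prop :=
  {in I, continuous alpha} /\
  forall t c, I t -> atlas c -> dom c (alpha t) ->
    let u := phi c \o alpha in
    let u' := derive1 u in
    [/\ derivable u t 1, derivable u' t 1 &
        forall k : 'I_n,
          derive1 u' t 0 k +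
          \sum_i \sum_j christoffel c (u t) k i j * u' t 0 i * u' t 0 j = 0].

(* exp_p(X) is defined and equal to q. *)
Definition exp_map (p : M) (X : functional) (q : M) : Prop :=
  exists (alpha : R -> M) (e : R),
    [/\ 0 < e, geodesic_on [set t | - e < t < 1 + e] alpha,
        alpha 0 = p,
        (forall c, atlas c -> dom c p -> derive1 (phi c \o alpha) 0 = comps c X) &
        alpha 1 = q].

(* c is the inverse of x |-> exp_p (x^i e_i) on a star-shaped neighbourhood of
   0, where the e_i form an orthonormal basis of the tangent space. *)
Definition normal_coordinates (c : chart) (p : M) : Prop :=
  [/\ atlas c /\ dom c p,
      phi c p = 0,
      metric_mx c (phi c p) = 1%:M,
      forall x (t : R), img c x -> 0 <= t <= 1 -> img c (t *: x) &
      forall x, img c x -> exp_map p (vec_of c p x) (psi c x)].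

End NormalCoordinates.

Section ContactElements.
Variables (F : M -> functional -> R) (c : chart) (p : M).

Definition G_ (v : functional) : 'rV[R]_n :=
  \row_i vpartial F c i (tcoords c p v).

Definition C_ (v : functional) : 'rV[R]_n := comps c v.

Definition H_ (v : functional) : 'rV[R]_n :=
  \row_i hpartial F c i (tcoords c p v).

Definition f_ (i j : 'I_n) (v : functional) : R :=
  comps c v 0 i * vpartial F c j (tcoords c p v) -
  comps c v 0 j * vpartial F c i (tcoords c p v).

Definition vertically_contact (v : functional) : Prop :=
  ~~ free [:: G_ v; C_ v].

Definition horizontal_contact (v : functional) : Prop := H_ v = 0.

Definition v_solvable : Prop :=
  forall v, tangent p v -> v <> 0 ->
  exists rho : 'I_n -> R, forall i : 'I_n,
    \sum_j f_ i j v * rho j = - hpartial F c i (tcoords c p v).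

End ContactElements.

End Manifold.

(* Main.v *)
Require Import Defs.
From mathcomp Require Import all_boot all_order all_algebra.
From mathcomp Require Import all_classical all_reals all_analysis.
From mathcomp Require Import ring.
Import Order.TTheory GRing.Theory Num.Theory.
Import numFieldNormedType.Exports.
Local Open Scope classical_set_scope.
Local Open Scope ring_scope.

(** At a fixed tangent vector the statement is linear algebra about the three
    rows y = [C_ v], G = [G_ v] and H = [H_ v]: the matrix f of the system is
    the alternating matrix of the 2 x 2 minors of y and G, that is, the
    bivector y /\ G, and the cyclic identity says that the 3 x 3 minors of y, G, H
    vanish, that is, y /\ G /\ H = 0.

    If f rho = - H, then f = 0 forces H = 0, and the 3 x 3 minors vanish by the
    Pluecker relation between the minors of y and G, summed against rho.
    Conversely, if f = 0, then y and G are parallel ([free2_minor]), so H = 0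
    and rho = 0 is a solution.  If f i j != 0, then equations i and j determine
    a rho supported on {i, j}, and the vanishing of the 3 x 3 minor on columns
    i, j, k says exactly that this rho also solves equation k.

    The equivalence thus holds vector by vector ([solvable_minor2P]), and the
    theorem is its instance at all nonzero tangent vectors. *)

Section TwoByTwoMinors.
Context {K : fieldType} {n : nat}.
Implicit Types (y G H : 'rV[K]_n) (i j k : 'I_n).

Definition minor2 y G i j : K := y 0 i * G 0 j - y 0 j * G 0 i.

(** If all minors vanish and y is nonzero at index i, then G is the multiple of
    y with ratio G i / y i; conversely the minors of proportional rows cancel. *)
Lemma free2_minor y G : free [:: G; y] <-> exists i j, minor2 y G i j != 0.
Proof.
rewrite free_cons seq1_free span_seq1; split=> [/andP[GNy y0]|[i [j fij]]].
- have [i yi0] : exists i, y 0 i != 0 by apply/rV0Pn.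
  apply: contrapT => f0; move/negP: GNy; apply.
  apply/vlineP; exists (G 0 i / y 0 i); apply/rowP => j; rewrite !mxE.
  have : minor2 y G i j = 0.
    by apply/eqP/negPn/negP => fij; apply: f0; exists i, j.
  move=> /eqP; rewrite subr_eq0 => /eqP yG.
  by rewrite mulrAC [G 0 i * _]mulrC -yG mulrAC mulfV ?mul1r.
- apply/andP; split; apply: contraNN fij.
  + by move=> /vlineP[a ->]; rewrite /minor2 !mxE; apply/eqP; ring.
  + by move=> /eqP->; rewrite /minor2 !mxE !mul0r subr0.
Qed.

(** Summing over l the Pluecker relation
    f i j * f k l + f j k * f i l + f k i * f j l = 0 against rho l. *)
Lemma minor3_eq0 y G H (rho : 'I_n -> K) i j k :
    (forall i, \sum_l minor2 y G i l * rho l = - H 0 i) ->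
  minor2 y G i j * H 0 k + minor2 y G j k * H 0 i + minor2 y G k i * H 0 j = 0.
Proof.
move=> sol; have HE l : H 0 l = - \sum_m minor2 y G l m * rho m.
  by rewrite sol opprK.
rewrite !HE !mulrN -!opprD !mulr_sumr -!big_split big1 ?oppr0 //= => l _.
by rewrite /minor2; ring.
Qed.

Lemma solvable_minor2P y G H :
  (exists rho : 'I_n -> K, forall i, \sum_j minor2 y G i j * rho j = - H 0 i)
  <->
  (~~ free [:: G; y] -> H = 0) /\
  (forall i j k, i != j -> j != k -> i != k -> minor2 y G i j != 0 ->
     minor2 y G i j * H 0 k + minor2 y G j k * H 0 i + minor2 y G k i * H 0 j
     = 0).
Proof.
split=> [[rho sol]|[H0 minor3]].
- split=> [/negP dep|i j k _ _ _ _]; last exact: minor3_eq0 sol.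
  apply/rowP => i; rewrite mxE -[H 0 i]opprK -sol big1 ?oppr0 // => j _.
  have [->|fij] := eqVneq (minor2 y G i j) 0; first by rewrite mul0r.
  by case: dep; apply/free2_minor; exists i, j.
- have [/free2_minor[i [j fij]]|/H0->] := boolP (free [:: G; y]); last first.
    by exists (fun=> 0) => i; rewrite mxE oppr0 big1 // => j _; rewrite mulr0.
  have ij : i != j.
    by apply: contraNneq fij => ->; rewrite /minor2 subrr.
  (* Cramer's rule for equations i and j, whose matrix on columns i and j is
     alternating with off-diagonal entries f i j and - f i j. *)
  exists (fun l => if l == i then H 0 j / minor2 y G i j
                   else if l == j then - H 0 i / minor2 y G i j else 0) => k.
  rewrite (bigD1 i) //= (bigD1 j) 1?eq_sym //= big1 => [|l /andP[li lj]];
    last by rewrite (negPf li) (negPf lj) mulr0.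
  rewrite !eqxx eq_sym (negPf ij) addr0.
  (* Up to the factor f i j, this is the equation at k; the minor is
     alternating, so it vanishes also when k is i or j. *)
  have : minor2 y G i j * H 0 k + minor2 y G j k * H 0 i
         + minor2 y G k i * H 0 j = 0.
    have [->|ki] := eqVneq k i; first by rewrite /minor2; ring.
    have [->|kj] := eqVneq k j; first by rewrite /minor2; ring.
    by apply: minor3 => //; rewrite eq_sym.
  have -> : minor2 y G j k = - minor2 y G k j by rewrite /minor2; ring.
  move=> /eqP; rewrite -addrA addr_eq0 => /eqP fijH.
  apply: (mulfI fij); rewrite [RHS]mulrN fijH.
  by field.
Qed.

End TwoByTwoMinors.

Theorem proposition1 (R : realType) (n : nat) (M : topologicalType)
    (atlas : set (chart R n M)) (F : M -> functional R M -> R)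
    (gamma : M -> functional R M -> functional R M -> R)
    (p : M) (c : chart R n M)
    (hM : smooth_manifold atlas) (hconn : connected [set: M])
    (hF : finsler_metric atlas F) (hgamma : averaged_metric atlas F gamma)
    (hc : normal_coordinates atlas gamma c p) :
  v_solvable atlas F c p <->
    (forall v, tangent atlas p v -> v <> 0 ->
       vertically_contact atlas F c p v -> horizontal_contact atlas F c p v) /\
    (forall v, tangent atlas p v -> v <> 0 ->
       forall i j k : 'I_n, i != j -> j != k -> i != k ->
       f_ atlas F c p i j v != 0 ->
       f_ atlas F c p i j v * hpartial atlas F c k (tcoords c p v) +
       f_ atlas F c p j k v * hpartial atlas F c i (tcoords c p v) +
       f_ atlas F c p k i v * hpartial atlas F c j (tcoords c p v) = 0).
Proof.
have pt v : (exists rho : 'I_n -> R, forall i,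
    \sum_j f_ atlas F c p i j v * rho j =
    - hpartial atlas F c i (tcoords c p v)) <->
  (vertically_contact atlas F c p v -> horizontal_contact atlas F c p v) /\
  (forall i j k : 'I_n, i != j -> j != k -> i != k ->
     f_ atlas F c p i j v != 0 ->
     f_ atlas F c p i j v * hpartial atlas F c k (tcoords c p v) +
     f_ atlas F c p j k v * hpartial atlas F c i (tcoords c p v) +
     f_ atlas F c p k i v * hpartial atlas F c j (tcoords c p v) = 0).
  have fE i j : f_ atlas F c p i j v
      = minor2 (C_ c v) (G_ atlas F c p v) i j.
    by rewrite /minor2 /f_ /C_ /G_ !mxE.
  have HE i : hpartial atlas F c i (tcoords c p v) = H_ atlas F c p v 0 i.
    by rewrite mxE.
  have [solP Psol] := solvable_minor2P (C_ c v) (G_ atlas F c p v)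
    (H_ atlas F c p v).
  split=> [[rho sol]|[contact minor3]].
  - have [|contact minor3] := solP.
      by exists rho => i; rewrite -HE -sol; apply: eq_bigr => j _; rewrite fE.
    by split=> // i j k; rewrite !fE !HE; apply: minor3.
  - have [|rho sol] := Psol.
      by split=> // i j k; rewrite -!fE -!HE; apply: minor3.
    by exists rho => i; rewrite HE -sol; apply: eq_bigr => j _; rewrite fE.
split=> [sol|[contact minor3] v tv v0].
- by split=> v tv v0; have /pt[] := sol v tv v0.
- by apply/pt; split; [exact: contact|exact: minor3].
Qed.
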